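(* For every integer $n\geq 0$, the number $C_n^{(3)}$ equals the coefficient of $t^n$ in the power series expansion of \[ \frac{1+t^2+t^3+t^5}{(1-t)(1-t^3)(1-t^4)(1-t^6)} \] (this is the integer sequence A028289 of the OEIS, which begins $1,1,2,4,5,7,11,13,17,23,\dots$).
   Context: Let $\Lambda_3=\mathbb{Z}_{\geq 0}^3$ with standard basis vectors $\mathbf{e}(1),\mathbf{e}(2),\mathbf{e}(3)$. Let $X_3=\{(1,-2,0),(-2,1,0),(-1,-1,1),(0,0,-1)\}$ (equivalently, the set of vectors $\mathbf{e}(k)-\mathbf{e}(i)-\mathbf{e}(j)$ with $i,j,k\in\{1,2,3\}$ and $3\mid k-i-j$). For $\mathbf{v},\mathbf{w}\in\Lambda_3$ write $\mathbf{v}\lessdot\mathbf{w}$ if $\mathbf{v}=\mathbf{w}+\mathbf{x}$ for some $\mathbf{x}\in X_3$, and let $\prec$ be the transitive closure of $\lessdot$ on $\Lambda_3$ (so $\mathbf{v}\prec\mathbf{w}$ iff there is a chain $\mathbf{v}=\mathbf{u}_0\lessdot\mathbf{u}_1\lessdot\dots\lessdot\mathbf{u}_m=\mathbf{w}$ with $m\geq1$ and all $\mathbf{u}_j\in\Lambda_3$). For $\mathbf{v}\in\Lambda_3$ let $I(\mathbf{v})=\{\mathbf{v}\}\cup\{\mathbf{w}\in\Lambda_3:\mathbf{w}\prec\mathbf{v}\}$. Define $C_n^{(3)}=|I(n\mathbf{e}(1))|$. *)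

(* Defs.v *)
From mathcomp Require Import all_boot all_order all_algebra finmap.
From mathcomp Require Import boolp classical_sets functions cardinality.
From Stdlib Require Export Relation_Operators.

Set Implicit Arguments.
Unset Strict Implicit.
Unset Printing Implicit Defensive.

Import Order.TTheory GRing.Theory Num.Theory.

Local Open Scope classical_set_scope.
Local Open Scope ring_scope.

Notation Lambda3 := 'rV[nat]_3.

Definition e1 : Lambda3 := delta_mx ord0 ord0.

Definition ivec3 (a b c : int) : 'rV[int]_3 := \row_(i < 3) [:: a; b; c]`_i.

Definition X3 : seq 'rV[int]_3 :=
  [:: ivec3 1 (-2) 0; ivec3 (-2) 1 0; ivec3 (-1) (-1) 1; ivec3 0 0 (-1)].

Definition lessdot (v w : Lambda3) : Prop :=
  exists2 x, x \in X3 & map_mx Posz v = map_mx Posz w + x.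

Definition prec : Lambda3 -> Lambda3 -> Prop := clos_trans Lambda3 lessdot.

Definition I3 (v : Lambda3) : set Lambda3 := [set v] `|` [set w | prec w v].

(* fset_set sends infinite sets to the empty set, so the value is only
   meaningful together with finite_set (I3 (e1 *+ n)). *)
Definition C3 (n : nat) : nat := #|` fset_set (I3 (e1 *+ n))|%fset.

(* Coefficient of t^n in the power series of p / q, for q with constant
   coefficient 1: expand 1 / q as the geometric series in 1 - q, whose terms of
   index > n do not contribute.  Lemmas ratser_coefP and ratser_coef_uniq show
   that these are the coefficients of the unique power series c such that
   q * c = p. *)
Definition ratser_coef (R : comNzRingType) (p q : {poly R}) (n : nat) : R :=
  (p * \sum_(k < n.+1) (1 - q) ^+ k)`_n.

Lemma coef_mulXn_small (R : comNzRingType) (s r : {poly R}) (m n : nat) :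
  r`_0 = 0 -> (n < m)%N -> (s * r ^+ m)`_n = 0.
Proof.
move=> r0 ltnm.
have -> : r = drop_poly 1 r * 'X.
  rewrite -[LHS](poly_take_drop 1) expr1 [take_poly 1 r](_ : _ = 0) ?add0r //.
  by apply/polyP=> -[|i]; rewrite coef_take_poly coef0 //= r0.
by rewrite exprMn mulrA coefMXn ltnm.
Qed.

Lemma ratser_coef_trunc (R : comNzRingType) (p q : {poly R}) (m n : nat) :
  q`_0 = 1 -> (n <= m)%N ->
  (p * \sum_(k < m.+1) (1 - q) ^+ k)`_n = ratser_coef p q n.
Proof.
move=> q0; elim: m => [|m IHm]; first by rewrite leqn0 => /eqP->.
rewrite leq_eqVlt => /predU1P[-> //|lenm].
rewrite big_ord_recr mulrDr coefD IHm // coef_mulXn_small ?addr0 //.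
by rewrite coefB q0 coef1 subrr.
Qed.

Lemma ratser_coefP (R : comNzRingType) (p q : {poly R}) (n : nat) :
  q`_0 = 1 -> \sum_(i < n.+1) q`_i * ratser_coef p q (n - i)%N = p`_n.
Proof.
move=> q0.
transitivity (q * (p * \sum_(k < n.+1) (1 - q) ^+ k))`_n.
  rewrite coefM; apply: eq_bigr => i _.
  by rewrite ratser_coef_trunc // leq_subr.
rewrite mulrCA.
have -> : q * \sum_(k < n.+1) (1 - q) ^+ k = 1 - (1 - q) ^+ n.+1.
  rewrite -{2}(expr1n _ n.+1) subrXX subKr; congr (_ * _).
  by apply: eq_bigr => i _; rewrite expr1n mul1r.
rewrite mulrBr mulr1 coefB coef_mulXn_small ?subr0 //.
by rewrite coefB q0 coef1 subrr.
Qed.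

Lemma ratser_coef_uniq (R : comNzRingType) (p q : {poly R}) (c : nat -> R) :
  q`_0 = 1 ->
  (forall n, \sum_(i < n.+1) q`_i * c (n - i)%N = p`_n) ->
  c =1 ratser_coef p q.
Proof.
move=> q0 cP n; elim/ltn_ind: n => n IHn.
have := cP n; rewrite -(ratser_coefP p n q0) !big_ord_recl !subn0 q0 !mul1r.
under eq_bigr => i _ do rewrite IHn ?ltn_subrL ?(leq_ltn_trans _ (ltn_ord i)) //.
by move/addIr.
Qed.

(* Main.v *)
Require Import Defs.
From mathcomp Require Import all_boot all_order all_algebra.
From mathcomp Require Import classical_sets cardinality.
From mathcomp Require Import finmap zify ring.

(** Each step of X3 keeps the weight a + 2 b + 3 c of (a, b, c) or lowers it by
    3.  Conversely, if n = a + 2 b + 3 c + 3 s then (n, 0, 0) reaches (a, b, c)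
    by b + c + s steps (-2, 1, 0), then c + s steps (-1, -1, 1), then s steps
    (0, 0, -1).  So C3 n counts the solutions of a + 2 b + 3 c + 3 s = n, with
    generating function 1 / ((1 - t) (1 - t^2) (1 - t^3)^2).  This is the
    fraction of the theorem, because 1 + t^2 + t^3 + t^5 = (1 + t^2) (1 + t^3). *)

Set Implicit Arguments.
Unset Strict Implicit.
Unset Printing Implicit Defensive.

Import GRing.Theory.
Local Open Scope ring_scope.

(** Reduces a claim on coefficients to one polynomial identity, which [ring] can check. The
    truncated geometric series [S] inverts [q] up to [(1 - q) ^+ n.+1], which starts beyond degree
    [n], just as ['X^m] does. *)
Lemma ratser_coef_trunc_eq (R : comNzRingType) (p q r z : {poly R}) (m n : nat) :
  q`_0 = 1 -> q * r = p + z * 'X^m -> (n < m)%N -> ratser_coef p q n = r`_n.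
Proof.
move=> q0 qr ltnm; rewrite /ratser_coef.
set S := \sum_(k < _) _.
have qS : q * S = 1 - (1 - q) ^+ n.+1.
  rewrite -[X in _ = X - _](expr1n _ n.+1) subrXX subKr; congr (_ * _).
  by apply: eq_bigr => i _; rewrite expr1n mul1r.
have -> : p = q * r - z * 'X^m by rewrite qr addrK.
have -> : (q * r - z * 'X^m) * S = r * (q * S) - z * S * 'X^m by ring.
rewrite qS mulrBr mulr1 !coefB coefMXn ltnm subr0 coef_mulXn_small ?subr0 //.
by rewrite coefB q0 coef1 subrr.
Qed.

Lemma geom_polyXn (R : comNzRingType) (d m : nat) :
  (1 - 'X^d) * (\sum_(k < m) 'X^(d * k)) = 1 - 'X^(d * m) :> {poly R}.
Proof.
rewrite exprM -[X in _ = X - _](expr1n _ m) subrXX; congr (_ * _).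
by apply: eq_bigr => i _; rewrite expr1n mul1r exprM.
Qed.

(* The exponent 1 * k is the instance d = 1 of geom_polyXn. *)
Lemma coefXnM_geom (R : comNzRingType) (w n : nat) :
  ('X^w * \sum_(k < n.+1) 'X^(1 * k) : {poly R})`_n = (w <= n)%:R.
Proof.
rewrite coefXnM ltnNge; case: leqP => //= lewn.
have lt : (n - w < n.+1)%N by lia.
rewrite coef_sum (bigD1 (Ordinal lt)) //= mul1n coefXn eqxx big1 ?addr0 // => i.
by rewrite -val_eqE /= mul1n coefXn eq_sym => /negbTE->.
Qed.

Definition vec3 (a b c : nat) : Lambda3 := \row_(i < 3) [:: a; b; c]`_i.

Definition weight3 (v : Lambda3) : nat :=
  (v ord0 0%R + 2 * v ord0 1%R + 3 * v ord0 2%R)%N.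

Lemma vec3_eta (v : Lambda3) : v = vec3 (v ord0 0) (v ord0 1) (v ord0 2).
Proof.
apply/rowP => i; rewrite mxE.
by case: i => -[|[|[|//]]] lti /=; congr (v _ _); apply: val_inj.
Qed.

Lemma e1_vec3 (n : nat) : e1 *+ n = vec3 n 0 0.
Proof.
apply/rowP => i; rewrite mulmxnE !mxE.
case: i => -[|[|[|//]]] lti /=; rewrite ?mul0rn //.
by rewrite -[RHS]natn.
Qed.

Lemma lessdot_vec3 (a b c a' b' c' : nat) (x y z : int) :
  ivec3 x y z \in X3 ->
  [/\ Posz a = Posz a' + x, Posz b = Posz b' + y & Posz c = Posz c' + z] ->
  lessdot (vec3 a b c) (vec3 a' b' c').
Proof.
move=> xX [ea eb ec]; exists (ivec3 x y z) => //.
by apply/rowP => i; rewrite !mxE; case: i => -[|[|[|//]]] lti.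
Qed.

Lemma lessdot_weight3 (v w : Lambda3) :
  lessdot v w -> exists s, weight3 w = (weight3 v + 3 * s)%N.
Proof.
case=> x xX /matrixP E.
have := (E ord0 0, E ord0 1, E ord0 2); rewrite !mxE /weight3.
move: (v ord0 0) (v ord0 1) (v ord0 2) => a b c.
move: (w ord0 0) (w ord0 1) (w ord0 2) => a' b' c'.
(* In the order of [X3], the weight drops by 3, 0, 0 and 3. *)
move: xX; rewrite !inE => /or4P[] /eqP->; rewrite !mxE /= => -[[ea eb] ec];
  [exists 1%N | exists 0%N | exists 0%N | exists 1%N]; lia.
Qed.

Lemma I3_weight3 (v w : Lambda3) :
  I3 v w -> exists s, weight3 v = (weight3 w + 3 * s)%N.
Proof.
case=> [->|/=]; first by exists 0%N; rewrite addn0.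
elim=> {v w} [v w /lessdot_weight3 //|u v w _ [s es] _ [s' es']].
by exists (s + s')%N; rewrite es' es mulnDr [in RHS]addnA.
Qed.

Lemma I3_trans (u v w : Lambda3) : I3 u v -> I3 v w -> I3 u w.
Proof.
case=> [->//|uv] [->|vw]; first by right.
by right; apply: t_trans vw uv.
Qed.

Lemma I3_iter (u : nat -> Lambda3) (m : nat) :
  (forall k, (k < m)%N -> lessdot (u k.+1) (u k)) -> I3 (u 0%N) (u m).
Proof.
elim: m => [|m IHm] H; first by left.
apply: I3_trans (IHm _) _; first by move=> k ltkm; apply: H; apply: ltnW.
by right; apply: t_step; apply: H.
Qed.

Lemma I3_reach (a b c s : nat) :
  I3 (vec3 (a + 2 * b + 3 * c + 3 * s) 0 0) (vec3 a b c).
Proof.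
set n := (_ + _ + _ + _)%N.
(* Positions after [k] steps of each phase. The truncated subtractions stay exact: the first entry
   only decreases, and it ends at [n - 2 * (b + c + s) - (c + s) = a]. *)
pose u1 k := vec3 (n - 2 * k) k 0.
pose u2 k := vec3 (n - 2 * (b + c + s) - k) (b + c + s - k) k.
pose u3 k := vec3 a b (c + s - k).
have -> : vec3 n 0 0 = u1 0%N by rewrite /u1 subn0.
have -> : vec3 a b c = u3 s by rewrite /u3 addnK.
apply: (@I3_trans _ (u1 (b + c + s)%N)).
  apply: I3_iter => k ltk; apply: (@lessdot_vec3 _ _ _ _ _ _ (-2) 1 0).
    by rewrite !inE eqxx ?orbT.
  by split; lia.
have -> : u1 (b + c + s)%N = u2 0%N by rewrite /u2 !subn0.
apply: (@I3_trans _ (u2 (c + s)%N)).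
  apply: I3_iter => k ltk; apply: (@lessdot_vec3 _ _ _ _ _ _ (-1) (-1) 1).
    by rewrite !inE eqxx ?orbT.
  by split; lia.
have -> : u2 (c + s)%N = u3 0%N by rewrite /u2 /u3; congr vec3; lia.
apply: I3_iter => k ltk; apply: (@lessdot_vec3 _ _ _ _ _ _ 0 0 (-1)).
  by rewrite !inE eqxx ?orbT.
by split; lia.
Qed.

(* A triple (b, c, s); the entry a is the slack in the inequality. *)
Definition reach_param (n : nat) : {set 'I_n.+1 * 'I_n.+1 * 'I_n.+1} :=
  [set t : 'I_n.+1 * 'I_n.+1 * 'I_n.+1 | 2 * t.1.1 + 3 * t.1.2 + 3 * t.2 <= n]%N.

Definition reach_vec (n : nat) (t : 'I_n.+1 * 'I_n.+1 * 'I_n.+1) : Lambda3 :=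
  vec3 (n - (2 * t.1.1 + 3 * t.1.2 + 3 * t.2)) t.1.1 t.1.2.

(** The vector does not display [s], but its first entry determines it, since on [reach_param n] the
    subtraction from [n] is exact. *)
Lemma reach_vec_inj (n : nat) : {in reach_param n &, injective (@reach_vec n)}.
Proof.
move=> [[b c] s] [[b' c'] s']; rewrite !inE /= => le le' /rowP E.
have := (E 0, E 1, E 2); rewrite !mxE /= => -[[ea eb] ec].
by do 2?congr (_, _); apply: val_inj => //=; lia.
Qed.

Lemma I3_e1_image (n : nat) :
  I3 (e1 *+ n) = [set` [fset reach_vec t | t in reach_param n]%fset]%classic.
Proof.
apply/seteqP; split=> [v /I3_weight3 [s]|_ /= /imfsetP[[[b c] s] /= + ->]].
  rewrite e1_vec3 {1}/weight3 !mxE /= [v]vec3_eta /weight3 !mxE /=.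
  move: (v ord0 0) (v ord0 1) (v ord0 2) => a b c E.
  have ltb : (b < n.+1)%N by lia.
  have ltc : (c < n.+1)%N by lia.
  have lts : (s < n.+1)%N by lia.
  have tP : (Ordinal ltb, Ordinal ltc, Ordinal lts) \in reach_param n.
    by rewrite inE /=; lia.
  apply/imfsetP; exists (Ordinal ltb, Ordinal ltc, Ordinal lts) => //.
  by rewrite /reach_vec /=; congr vec3; lia.
rewrite inE /= => le; rewrite e1_vec3 /reach_vec /=.
set a := (n - _)%N.
rewrite [X in vec3 X 0 0](_ : _ = a + 2 * b + 3 * c + 3 * s)%N; last first.
  by rewrite /a; lia.
exact: I3_reach.
Qed.

Lemma finite_I3_e1 (n : nat) : finite_set (I3 (e1 *+ n)).
Proof. by rewrite I3_e1_image; apply: finite_fset. Qed.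

Lemma C3_card (n : nat) : C3 n = #|reach_param n|.
Proof.
rewrite /C3 I3_e1_image set_fsetK card_in_imfset /=; last exact: reach_vec_inj.
by rewrite cardE.
Qed.

Definition geom4 (m : nat) : {poly int} :=
  (\sum_(i < m) 'X^(2 * i)) * (\sum_(j < m) 'X^(3 * j))
  * (\sum_(k < m) 'X^(3 * k)) * \sum_(k < m) 'X^(1 * k).

(** The first three factors expand into one monomial per triple [(b, c, s)]; the last factor
    supplies the slack [a], so a triple contributes 1 exactly when its weight is at most [n]. *)
Lemma coef_geom4 (n : nat) : (geom4 n.+1)`_n = #|reach_param n|%:Z.
Proof.
rewrite /geom4 big_distrlr /= pair_big big_distrlr /= pair_big /=.
rewrite mulr_suml coef_sum.
transitivity (\sum_t (t \in reach_param n)%:R : int).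
  apply: eq_bigr => t _; rewrite inE -coefXnM_geom.
  by rewrite !exprD.
by rewrite -natr_sum natz -big_mkcond sum1_card.
Qed.

Theorem theorem3p9 :
  let num : {poly int} := 1 + 'X^2 + 'X^3 + 'X^5 in
  let den : {poly int} := (1 - 'X) * (1 - 'X^3) * (1 - 'X^4) * (1 - 'X^6) in
  (forall n : nat,
     finite_set (I3 (e1 *+ n)) /\ (C3 n)%:Z = ratser_coef num den n)
  /\ [seq ratser_coef num den n | n <- iota 0 10]
     = [:: 1; 1; 2; 4; 5; 7; 11; 13; 17; 23].
Proof.
move=> num den.
have den0 : den`_0 = 1 by rewrite -horner_coef0 !hornerE /=.
split=> [n|].
  split; first exact: finite_I3_e1.
  rewrite C3_card -coef_geom4; symmetry.
  pose Y : {poly int} := 'X^(n.+1).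
  have geomY d :
      (1 - 'X^d) * (\sum_(k < n.+1) 'X^(d * k)) = 1 - Y ^+ d :> {poly int}.
    by rewrite geom_polyXn mulnC exprM.
  (* As [1 - t^4] and [1 - t^6] split off [1 + t^2] and [1 + t^3], [den] is [num] times
     [(1 - t) (1 - t^2) (1 - t^3)^2], and each of these factors telescopes against its series in
     [geom4]. *)
  have denM :
      den * geom4 n.+1 = num * ((1 - Y) * (1 - Y ^+ 2) * (1 - Y ^+ 3) ^+ 2).
    by rewrite -[X in 1 - X]expr1 -!geomY /den /num /geom4; ring.
  (* The cofactor is ((1 - Y) (1 - Y^2) (1 - Y^3)^2 - 1) / Y. *)
  apply: (@ratser_coef_trunc_eq _ _ _ _
    (num * (Y ^+ 8 - Y ^+ 7 - Y ^+ 6 - Y ^+ 5 + 2 * Y ^+ 4 + 2 * Y ^+ 3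
            - Y ^+ 2 - Y - 1)) n.+1 _ den0 _ (ltnSn n)).
  by rewrite denM -/Y; ring.
(* The ten values are certified by comparing [den * r] with [num] below degree 10, without expanding
   [ratser_coef]. *)
pose r : {poly int} := Poly [:: 1; 1; 2; 4; 5; 7; 11; 13; 17; 23].
pose z : {poly int} :=
  Poly [:: -27; -6; -9; 21; 24; 3; 33; -18; 8; -21; -25; -4; -6; 23].
(* z is the part of den * r of degree at least 10. *)
have denr : den * r = num + z * 'X^10.
  by rewrite /r /z /= !cons_poly_def /den /num; ring.
transitivity [seq r`_n | n <- iota 0 10]; last by rewrite /= !coef_Poly.
apply/eq_in_map => n; rewrite mem_iota => /andP[_ lt].
exact: ratser_coef_trunc_eq den0 denr lt.
Qed.
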